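(* Every Henkin set $\Phi\subseteq Fm(C)$ has a normal model, i.e., there exist a normal $S3^\forall_\equiv$-model $\mathcal{M}$ and an assignment $\beta$ with $(\mathcal{M},\beta)\vDash\varphi\Leftrightarrow\varphi\in\Phi$ for all $\varphi\in Fm(C)$.
   Context: Language: $Fm(C)$ is the set of formulas built from propositional variables $V$, a set $C$ of propositional constants containing $\top,\bot$, connectives $\neg,\rightarrow,\vee,\wedge$, identity connective $\equiv$, necessity $\square$ and universal propositional quantifier $\forall$ ($\forall x\varphi$ formed only if $x$ free in $\varphi$). $\varphi[x:=\psi]$ is capture-avoiding substitution; $=_\alpha$ is alpha-congruence. The system $S3^\forall_\equiv$ has axioms: (i) substitution-instances of propositional tautologies; (ii) $\square\varphi\rightarrow\varphi$; (iii) $\square(\varphi\rightarrow\psi)\rightarrow(\square\varphi\rightarrow\square\psi)$; (iv) $\square(\varphi\rightarrow\psi)\rightarrow\square(\square\varphi\rightarrow\square\psi)$; (v) $\varphi\equiv\psi$ if $\varphi=_\alpha\psi$; (vi) $(\varphi\equiv\psi)\rightarrow(\varphi\rightarrow\psi)$; (vii) $(\psi\equiv\psi')\rightarrow(\varphi[x:=\psi]\equiv\varphi[x:=\psi'])$, $x$ free in $\varphi$; (viii) $\forall x(\varphi\equiv\psi)\rightarrow(\forall x\varphi\equiv\forall x\psi)$; (ix) $\forall x\varphi\rightarrow\varphi[x:=\psi]$; (x) $\forall x(\varphi\rightarrow\psi)\rightarrow(\forall x\varphi\rightarrow\forall x\psi)$; (xi) $\forall x(\varphi\rightarrow\psi)\rightarrow(\varphi\rightarrow\forall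 x\psi)$, $x$ not free in $\varphi$; (xii) $\square\forall x\varphi\rightarrow\forall x\square\varphi$; (xiii) $\forall x\square\varphi\rightarrow\square\forall x\varphi$; closed under: $\varphi$ axiom and $x$ free in $\varphi$ implies $\forall x\varphi$ axiom. Rules: Modus Ponens and Axiom Necessitation (from an axiom $\varphi$ infer $\square\varphi$). $\vdash_3$ is derivability in $S3^\forall_\equiv$. A Henkin set is a set $\Phi\subseteq Fm(C)$ that is maximally consistent (w.r.t. $\vdash_3$) and satisfies $\Phi\vdash_3\forall x\varphi\Leftrightarrow\Phi\vdash_3\varphi[x:=c]$ for all $c\in C$. Semantics: a propositional domain is $\mathcal{M}=(M,\mathit{TRUE},\mathit{NEC},f_\bot,f_\top,f_\square,f_\neg,f_\vee,f_\wedge,f_\rightarrow,f_\equiv,f_\forall,\varGamma)$ with $\mathit{TRUE},\mathit{NEC}\subseteq M$, operations of obvious arities, $f_\forall\colon M^M\to M$, $\varGamma\colon C\to M$ with $\varGamma(\bot)=f_\bot,\varGamma(\top)=f_\top$; assignments $\gamma\colon V\to M$ extend homomorphically with $\gamma(c)=\varGamma(c)$ and $\gamma(\forall x\varphi)=f_\forall(m\mapsto\gamma_x^m(\varphi))$. $t\colon M\to M$ is $(\varphi,x,\gamma)$-definable if $t(m)=\gamma_x^m(\varphi)$ for all $m$ (definable if so for some $\varphi,x,\gamma$). With $a\le_\mathcal{M}b:\Leftrightarrow f_\rightarrow(a,b)\in\mathit{NEC}$ and $\approx_\mathcal{M}$ its symmetric part, $\mathcal{M}$ is an $S3^\forall_\equiv$-model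 if: (1) when $\mathit{NEC}\neq\varnothing$, $\le_\mathcal{M}$ is a preorder making $(M,f_\bot,f_\top,f_\neg,f_\vee,f_\wedge,f_\rightarrow,\le_\mathcal{M})$ a Boolean prealgebra ($\approx_\mathcal{M}$ a congruence with Boolean-algebra quotient ordered by $\le_\mathcal{M}$); (2) $f_\bot\notin\mathit{TRUE}$, $f_\top\in\mathit{TRUE}$, classical truth conditions for $f_\rightarrow,f_\neg,f_\wedge,f_\vee$, $f_\square(a)\in\mathit{TRUE}\Leftrightarrow a\in\mathit{NEC}$, $f_\equiv(a,b)\in\mathit{TRUE}\Leftrightarrow a=b$, $f_\forall(t)\in\mathit{TRUE}$ for definable $t$ with image in $\mathit{TRUE}$; (3) when $\mathit{NEC}\neq\varnothing$, $\mathit{NEC}\subseteq\mathit{TRUE}$ is upward closed under $\le_\mathcal{M}$ and closed under $f_\wedge$; (4) when $\mathit{NEC}\neq\varnothing$, the algebraic counterparts of the axioms hold: $f_\top\le_\mathcal{M}f_\equiv(a,a)$; $f_\equiv(a,b)\le_\mathcal{M}f_\rightarrow(a,b)$; $f_\equiv(a,b)\le_\mathcal{M}f_\equiv(t(a),t(b))$ for definable $t$; $f_\square(a)\le_\mathcal{M}a$; $f_\square(f_\rightarrow(a,b))\le_\mathcal{M}f_\rightarrow(f_\square(a),f_\square(b))$; $f_\square(f_\rightarrow(a,b))\le_\mathcal{M}f_\square(f_\rightarrow(f_\square(a),f_\square(b)))$; $f_\forall(t)\le_\mathcal{M}f_\equiv(f_\forall(t_1),f_\forall(t_2))$ and $f_\forall(t)\le_\mathcal{M}f_\rightarrow(f_\forall(t_1),f_\forall(t_2))$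 for $t_1,t_2$ $(\varphi,x,\gamma)$-, $(\psi,x,\gamma)$-definable and $t$ the pointwise $f_\equiv$, resp. $f_\rightarrow$, of $t_1,t_2$; $f_\forall(t)\le_\mathcal{M}t(a)$ for definable $t$; $f_\forall(t)\le_\mathcal{M}f_\rightarrow(b,f_\forall(t'))$ for $t'$ $(\psi,x,\gamma)$-definable, $b$ the denotation of a sentence and $t(a)=f_\rightarrow(b,t'(a))$; $f_\square(f_\forall(t))\approx_\mathcal{M}f_\forall(a\mapsto f_\square(t(a)))$ for definable $t$; $f_\forall(t)\in\mathit{NEC}$ for definable $t$ with image in $\mathit{NEC}$. It is normal if $\mathit{NEC}\neq\varnothing$. $(\mathcal{M},\gamma)\vDash\varphi:\Leftrightarrow\gamma(\varphi)\in\mathit{TRUE}$.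
   Formalization: In the model condition f_∀(t) ≤ f_≡(f_∀(t1), f_∀(t2)) for (φ,x,γ)-, (ψ,x,γ)-definable t1, t2, the variable x is required to be free in both φ and ψ, as in axiom (viii); without this some Henkin sets have no normal model. *)

(* Defs.v *)
From mathcomp Require Import all_boot.

Set Implicit Arguments.
Unset Strict Implicit.
Unset Printing Implicit Defensive.

Record constants := Constants {
  const :> Type;
  ctop : const;
  cbot : const;
  ctop_neq_cbot : ctop <> cbot }.

(* Propositional variables are the natural numbers. [fm C] contains vacuous
   quantifications; the formulas of Fm(C) are those satisfying [Fm] below. *)
Inductive fm (C : constants) : Type :=
| Var of nat
| Const of C
| Neg of fm C
| Imp of fm C & fm C
| Or of fm C & fm C
| And of fm C & fm C
| Eqv of fm C & fm C
| Box of fm C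
| All of nat & fm C.

Arguments Var {C} _.
Arguments Const {C} _.

Section Syntax.
Variable C : constants.
Implicit Types (phi psi chi : fm C) (x y : nat) (Phi Psi : fm C -> Prop).

Definition Top : fm C := Const (ctop C).
Definition Bot : fm C := Const (cbot C).

Fixpoint fvars phi : seq nat :=
  match phi with
  | Var x => [:: x]
  | Const _ => [::]
  | Neg p | Box p => fvars p
  | Imp p q | Or p q | And p q | Eqv p q => fvars p ++ fvars q
  | All x p => [seq y <- fvars p | y != x]
  end.

Fixpoint Fm phi : bool :=
  match phi with
  | Var _ | Const _ => true
  | Neg p | Box p => Fm p
  | Imp p q | Or p q | And p q | Eqv p q => Fm p && Fm q
  | All x p => (x \in fvars p) && Fm p
  end.

Definition sentence phi : Prop := Fm phi /\ fvars phi = [::].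

Definition fresh (s : seq nat) : nat := (\max_(i <- s) i).+1.

Definition upd (T : Type) (g : nat -> T) x (m : T) : nat -> T :=
  fun y => if y == x then m else g y.

(* Simultaneous substitution; a bound variable is renamed exactly when it would
   capture a free variable of one of the formulas being substituted. *)
Fixpoint subst (s : nat -> fm C) phi : fm C :=
  match phi with
  | Var x => s x
  | Const c => Const c
  | Neg p => Neg (subst s p)
  | Imp p q => Imp (subst s p) (subst s q)
  | Or p q => Or (subst s p) (subst s q)
  | And p q => And (subst s p) (subst s q)
  | Eqv p q => Eqv (subst s p) (subst s q)
  | Box p => Box (subst s p)
  | All x p =>
      let vs := flatten [seq fvars (s u) | u <- fvars p & u != x] in
      let y := if x \in vs then fresh vs else x in
      All y (subst (upd s x (Var y)) p)
  end.

Definition subst1 phi x psi : fm C := subst (upd Var x psi) phi.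

Inductive alpha : fm C -> fm C -> Prop :=
| alpha_refl phi : alpha phi phi
| alpha_sym phi psi : alpha phi psi -> alpha psi phi
| alpha_trans phi psi chi : alpha phi psi -> alpha psi chi -> alpha phi chi
| alpha_neg p p' : alpha p p' -> alpha (Neg p) (Neg p')
| alpha_imp p p' q q' :
    alpha p p' -> alpha q q' -> alpha (Imp p q) (Imp p' q')
| alpha_or p p' q q' :
    alpha p p' -> alpha q q' -> alpha (Or p q) (Or p' q')
| alpha_and p p' q q' :
    alpha p p' -> alpha q q' -> alpha (And p q) (And p' q')
| alpha_eqv p p' q q' :
    alpha p p' -> alpha q q' -> alpha (Eqv p q) (Eqv p' q')
| alpha_box p p' : alpha p p' -> alpha (Box p) (Box p')
| alpha_all x p p' : alpha p p' -> alpha (All x p) (All x p')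
| alpha_rename x y p :
    y \notin fvars p -> alpha (All x p) (All y (subst1 p x (Var y))).

Inductive pl : Type :=
| PVar of nat
| PTop
| PBot
| PNeg of pl
| PImp of pl & pl
| POr of pl & pl
| PAnd of pl & pl.

Fixpoint pl_eval (v : nat -> bool) (p : pl) : bool :=
  match p with
  | PVar n => v n
  | PTop => true
  | PBot => false
  | PNeg q => ~~ pl_eval v q
  | PImp q r => pl_eval v q ==> pl_eval v r
  | POr q r => pl_eval v q || pl_eval v r
  | PAnd q r => pl_eval v q && pl_eval v r
  end.

Definition tautology (p : pl) : Prop := forall v, pl_eval v p.

Fixpoint pl_inst (s : nat -> fm C) (p : pl) : fm C :=
  match p with
  | PVar n => s n
  | PTop => Top
  | PBot => Bot
  | PNeg q => Neg (pl_inst s q)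
  | PImp q r => Imp (pl_inst s q) (pl_inst s r)
  | POr q r => Or (pl_inst s q) (pl_inst s r)
  | PAnd q r => And (pl_inst s q) (pl_inst s r)
  end.

(* The premises [Fm (All x phi)] contain the requirement that x is free in
   phi. *)
Inductive axiom3 : fm C -> Prop :=
| ax_taut p s :
    tautology p -> (forall n, Fm (s n)) -> axiom3 (pl_inst s p)
| ax_T phi :
    Fm phi -> axiom3 (Imp (Box phi) phi)
| ax_K phi psi :
    Fm phi -> Fm psi ->
    axiom3 (Imp (Box (Imp phi psi)) (Imp (Box phi) (Box psi)))
| ax_S3 phi psi :
    Fm phi -> Fm psi ->
    axiom3 (Imp (Box (Imp phi psi)) (Box (Imp (Box phi) (Box psi))))
| ax_alpha phi psi :
    Fm phi -> Fm psi -> alpha phi psi -> axiom3 (Eqv phi psi)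
| ax_eqv_imp phi psi :
    Fm phi -> Fm psi -> axiom3 (Imp (Eqv phi psi) (Imp phi psi))
| ax_eqv_subst phi x psi psi' :
    Fm phi -> Fm psi -> Fm psi' -> x \in fvars phi ->
    axiom3 (Imp (Eqv psi psi') (Eqv (subst1 phi x psi) (subst1 phi x psi')))
| ax_all_eqv x phi psi :
    Fm (All x phi) -> Fm (All x psi) ->
    axiom3 (Imp (All x (Eqv phi psi)) (Eqv (All x phi) (All x psi)))
| ax_all_inst x phi psi :
    Fm (All x phi) -> Fm psi -> axiom3 (Imp (All x phi) (subst1 phi x psi))
| ax_all_imp x phi psi :
    Fm (All x phi) -> Fm (All x psi) ->
    axiom3 (Imp (All x (Imp phi psi)) (Imp (All x phi) (All x psi)))
| ax_all_const x phi psi :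
    Fm phi -> Fm (All x psi) -> x \notin fvars phi ->
    axiom3 (Imp (All x (Imp phi psi)) (Imp phi (All x psi)))
| ax_box_all x phi :
    Fm (All x phi) -> axiom3 (Imp (Box (All x phi)) (All x (Box phi)))
| ax_all_box x phi :
    Fm (All x phi) -> axiom3 (Imp (All x (Box phi)) (Box (All x phi)))
| ax_gen x phi :
    axiom3 phi -> x \in fvars phi -> axiom3 (All x phi).

Inductive derives Phi : fm C -> Prop :=
| derives_hyp phi : Phi phi -> derives Phi phi
| derives_ax phi : axiom3 phi -> derives Phi phi
| derives_mp phi psi :
    derives Phi phi -> derives Phi (Imp phi psi) -> derives Phi psi
| derives_nec phi : axiom3 phi -> derives Phi (Box phi).

Definition fm_set Phi : Prop := forall phi, Phi phi -> Fm phi.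

Definition consistent Phi : Prop := ~ derives Phi Bot.

Definition maximally_consistent Phi : Prop :=
  [/\ fm_set Phi, consistent Phi &
      forall Psi, fm_set Psi -> (forall phi, Phi phi -> Psi phi) ->
        consistent Psi -> forall phi, Psi phi -> Phi phi].

Definition henkin_set Phi : Prop :=
  maximally_consistent Phi /\
  forall x phi, Fm (All x phi) ->
    (derives Phi (All x phi) <->
     forall c : C, derives Phi (subst1 phi x (Const c))).

End Syntax.

Record prop_domain (C : constants) := PropDomain {
  pd :> Type;
  TRUE : pd -> Prop;
  NEC : pd -> Prop;
  f_bot : pd;
  f_top : pd;
  f_box : pd -> pd;
  f_neg : pd -> pd;
  f_or : pd -> pd -> pd;
  f_and : pd -> pd -> pd;
  f_imp : pd -> pd -> pd;
  f_eqv : pd -> pd -> pd;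
  f_all : (pd -> pd) -> pd;
  Gam : C -> pd;
  Gam_bot : Gam (cbot C) = f_bot;
  Gam_top : Gam (ctop C) = f_top }.

Section Semantics.
Variables (C : constants) (M : prop_domain C).
Implicit Types (a b c : M) (t : M -> M) (g : nat -> M).

Fixpoint eval g (phi : fm C) : M :=
  match phi with
  | Var x => g x
  | Const c => Gam M c
  | Neg p => f_neg (eval g p)
  | Imp p q => f_imp (eval g p) (eval g q)
  | Or p q => f_or (eval g p) (eval g q)
  | And p q => f_and (eval g p) (eval g q)
  | Eqv p q => f_eqv (eval g p) (eval g q)
  | Box p => f_box (eval g p)
  | All x p => f_all (fun m => eval (upd g x m) p)
  end.

Definition satisfies g (phi : fm C) : Prop := TRUE (eval g phi).

Definition definable_by (phi : fm C) x g t : Prop :=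
  Fm phi /\ forall m, t m = eval (upd g x m) phi.

Definition definable t : Prop := exists phi x g, definable_by phi x g t.

Definition leM a b : Prop := NEC (f_imp a b).

Definition approxM a b : Prop := leM a b /\ leM b a.

Definition normal : Prop := exists a, NEC a.

Record boolean_prealgebra : Prop := {
  le_refl a : leM a a;
  le_trans a b c : leM a b -> leM b c -> leM a c;
  approx_neg a a' : approxM a a' -> approxM (f_neg a) (f_neg a');
  approx_or a a' b b' :
    approxM a a' -> approxM b b' -> approxM (f_or a b) (f_or a' b');
  approx_and a a' b b' :
    approxM a a' -> approxM b b' -> approxM (f_and a b) (f_and a' b');
  approx_imp a a' b b' :
    approxM a a' -> approxM b b' -> approxM (f_imp a b) (f_imp a' b');
  (* the quotient by [approxM] is a Boolean algebra *)
  ba_orC a b : approxM (f_or a b) (f_or b a);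
  ba_andC a b : approxM (f_and a b) (f_and b a);
  ba_orA a b c : approxM (f_or a (f_or b c)) (f_or (f_or a b) c);
  ba_andA a b c : approxM (f_and a (f_and b c)) (f_and (f_and a b) c);
  ba_or_and a b : approxM (f_or a (f_and a b)) a;
  ba_and_or a b : approxM (f_and a (f_or a b)) a;
  ba_or_andD a b c :
    approxM (f_or a (f_and b c)) (f_and (f_or a b) (f_or a c));
  ba_and_orD a b c :
    approxM (f_and a (f_or b c)) (f_or (f_and a b) (f_and a c));
  ba_or_bot a : approxM (f_or a (f_bot M)) a;
  ba_and_top a : approxM (f_and a (f_top M)) a;
  ba_or_neg a : approxM (f_or a (f_neg a)) (f_top M);
  ba_and_neg a : approxM (f_and a (f_neg a)) (f_bot M);
  ba_imp a b : approxM (f_imp a b) (f_or (f_neg a) b);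
  (* and its lattice order is the one induced by [leM] *)
  ba_le a b : leM a b <-> approxM (f_and a b) a }.

Record truth_conditions : Prop := {
  tr_bot : ~ TRUE (f_bot M);
  tr_top : TRUE (f_top M);
  tr_imp a b : TRUE (f_imp a b) <-> (TRUE a -> TRUE b);
  tr_neg a : TRUE (f_neg a) <-> ~ TRUE a;
  tr_and a b : TRUE (f_and a b) <-> TRUE a /\ TRUE b;
  tr_or a b : TRUE (f_or a b) <-> TRUE a \/ TRUE b;
  tr_box a : TRUE (f_box a) <-> NEC a;
  tr_eqv a b : TRUE (f_eqv a b) <-> a = b;
  tr_all t : definable t -> (forall a, TRUE (t a)) -> TRUE (f_all t) }.

Record nec_conditions : Prop := {
  nec_true a : NEC a -> TRUE a;
  nec_up a b : NEC a -> leM a b -> NEC b;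
  nec_and a b : NEC a -> NEC b -> NEC (f_and a b) }.

Record axiom_conditions : Prop := {
  ac_eqv_refl a : leM (f_top M) (f_eqv a a);
  ac_eqv_imp a b : leM (f_eqv a b) (f_imp a b);
  ac_eqv_subst t a b :
    definable t -> leM (f_eqv a b) (f_eqv (t a) (t b));
  ac_T a : leM (f_box a) a;
  ac_K a b : leM (f_box (f_imp a b)) (f_imp (f_box a) (f_box b));
  ac_S3 a b :
    leM (f_box (f_imp a b)) (f_box (f_imp (f_box a) (f_box b)));
  (* Here x has to be free in both formulas, as in [ax_all_eqv]: if only psi
     contained x free, the condition would make true the formulas
       exists y, Box (All x (Eqv phi psi) -> Eqv y (All x psi))
              /\ Box (All x (Eqv phi psi') -> Eqv y (All x psi')),
     which are not derivable, y being the value of [f_all] at a constant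
     function. *)
  ac_all_eqv phi psi x g t1 t2 t :
    definable_by phi x g t1 -> definable_by psi x g t2 ->
    x \in fvars phi -> x \in fvars psi ->
    (forall a, t a = f_eqv (t1 a) (t2 a)) ->
    leM (f_all t) (f_eqv (f_all t1) (f_all t2));
  ac_all_imp phi psi x g t1 t2 t :
    definable_by phi x g t1 -> definable_by psi x g t2 ->
    (forall a, t a = f_imp (t1 a) (t2 a)) ->
    leM (f_all t) (f_imp (f_all t1) (f_all t2));
  ac_all_inst t a : definable t -> leM (f_all t) (t a);
  ac_all_const chi psi x g b t' t :
    sentence chi -> b = eval g chi ->
    definable_by psi x g t' ->
    (forall a, t a = f_imp b (t' a)) ->
    leM (f_all t) (f_imp b (f_all t'));
  ac_box_all t :
    definable t -> approxM (f_box (f_all t)) (f_all (fun a => f_box (t a)));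
  ac_all_nec t : definable t -> (forall a, NEC (t a)) -> NEC (f_all t) }.

Record s3_model : Prop := {
  s3_prealgebra : normal -> boolean_prealgebra;
  s3_truth : truth_conditions;
  s3_nec : normal -> nec_conditions;
  s3_axioms : normal -> axiom_conditions }.

End Semantics.

(* Main.v *)
(* The canonical model is Fm(C) modulo the relation "phi == psi belongs to Phi".
   The delicate point is the value of f_all.  If a function is given by
   chi |-> P[z := chi] with z free in P, its value is the class of "forall z P":
   Henkin's property and axiom (viii) make this independent of P.  A definable
   function admitting no such P is constant, and f_all returns its only value.
   In both cases f_all t is a greatest lower bound of the values of t for leM:
   by Henkin's property and the Barcan formula (xiii), if b -> P[z := c] is
   necessary for every constant c, so is "forall z (b -> P)", hence
   b -> "forall z P".  Most conditions on f_all are consequences of this. *)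

Require Import Defs.
From mathcomp Require Import all_boot.
From Stdlib Require Import ClassicalEpsilon FunctionalExtensionality.
From Stdlib Require Import PropExtensionality ProofIrrelevance.

Set Implicit Arguments.
Unset Strict Implicit.
Unset Printing Implicit Defensive.

(** * Capture-avoiding simultaneous substitution and alpha-congruence *)

Section Substitution.
Variable C : constants.
Implicit Types (p q chi : fm C) (s r : nat -> fm C) (x y z : nat).

Lemma fresh_notin (l : seq nat) : fresh l \notin l.
Proof.
apply/negP => fl; have /=: (fresh l <= \max_(i <- l) i)%N.
  by rewrite (big_rem _ fl) /= leq_maxl.
by rewrite /fresh ltnn.
Qed.

Lemma upd_same T (g : nat -> T) x m : upd g x m x = m.
Proof. by rewrite /upd eqxx. Qed.

Lemma upd_other T (g : nat -> T) x m y : y != x -> upd g x m y = g y.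
Proof. by rewrite /upd => /negPf ->. Qed.

(** This and [rename_bound] name the two local definitions in the quantifier clause of [subst], so
    that [subst_All] holds by conversion. *)
Definition captured s x p : seq nat :=
  flatten [seq fvars (s u) | u <- fvars p & u != x].

Definition rename_bound s x p : nat :=
  if x \in captured s x p then fresh (captured s x p) else x.

Lemma subst_All s x p :
  subst s (All x p) =
  All (rename_bound s x p) (subst (upd s x (Var (rename_bound s x p))) p).
Proof. by []. Qed.

Lemma capturedP s x p w :
  reflect (exists u, [/\ u \in fvars p, u != x & w \in fvars (s u)])
          (w \in captured s x p).
Proof.
apply: (iffP flattenP) => [[_ /mapP[u uf ->] wu]|[u [up ux wu]]].
  by move: uf; rewrite mem_filter => /andP[ux up]; exists u.
by exists (fvars (s u)) => //; apply: map_f; rewrite mem_filter ux.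
Qed.

Lemma rename_bound_notin s x p : rename_bound s x p \notin captured s x p.
Proof. by rewrite /rename_bound; case: ifPn => // _; apply: fresh_notin. Qed.

Lemma subst_ext p s r :
  (forall u, u \in fvars p -> s u = r u) -> subst s p = subst r p.
Proof.
elim: p s r => [n|c|p IH|p IHp q IHq|p IHp q IHq|p IHp q IHq|p IHp q IHq|p IH
               |x p IH] s r sr /=; rewrite ?sr ?inE //;
  try by rewrite ?(IH s r) ?(IHp s r) ?(IHq s r) // => u up; apply: sr;
         rewrite /= ?mem_cat up ?orbT.
have E : captured s x p = captured r x p.
  congr flatten; apply/eq_in_map => u; rewrite mem_filter => /andP[ux up].
  by rewrite sr //= mem_filter ux.
rewrite -/(captured s x p) -/(captured r x p) E; congr All.
apply: IH => u up; rewrite /upd; case: ifPn => // ux.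
by apply: sr; rewrite /= mem_filter ux.
Qed.

Lemma subst_id p s :
  (forall u, u \in fvars p -> s u = Var u) -> subst s p = p.
Proof.
elim: p s => [n|c|p IH|p IHp q IHq|p IHp q IHq|p IHp q IHq|p IHp q IHq|p IH
               |x p IH] s sV /=; rewrite ?sV ?inE //;
  try by rewrite ?(IH s) ?(IHp s) ?(IHq s) // => u up; apply: sV;
         rewrite /= ?mem_cat up ?orbT.
rewrite -/(captured s x p) ifN; last first.
  apply/capturedP => -[u [up ux]]; rewrite sV ?mem_filter ?ux ?up //= inE.
  by rewrite eq_sym (negPf ux).
rewrite IH // => u up; rewrite /upd; case: eqP => [->//|/eqP ux].
by apply: sV; rewrite /= mem_filter ux.
Qed.

Lemma fvars_substP p s w :
  reflect (exists2 u, u \in fvars p & w \in fvars (s u))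
          (w \in fvars (subst s p)).
Proof.
apply: (iffP idP).
- elim: p s => [n|c|p IH|p IHp q IHq|p IHp q IHq|p IHp q IHq|p IHp q IHq|p IH
               |x p IH] s /=.
  + by exists n; rewrite ?inE.
  + by [].
  + exact: IH.
  1-4: by rewrite mem_cat => /orP[/IHp|/IHq] [u up wu]; exists u;
       rewrite // mem_cat up ?orbT.
  + exact: IH.
  + rewrite mem_filter => /andP[wy /IH[u up]].
    rewrite /upd; case: eqP => [_|/eqP ux]; first by rewrite inE (negPf wy).
    by exists u; rewrite // mem_filter ux.
- elim: p s => [n|c|p IH|p IHp q IHq|p IHp q IHq|p IHp q IHq|p IHp q IHq|p IH
               |x p IH] s [u /=].
  + by rewrite inE => /eqP ->.
  + by [].
  + by move=> up wu; apply: IH; exists u.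
  1-4: by rewrite !mem_cat => /orP[up|uq] wu; apply/orP;
       [left; apply: IHp|right; apply: IHq]; exists u.
  + by move=> up wu; apply: IH; exists u.
  + rewrite mem_filter => /andP[ux up] wu.
    rewrite mem_filter -/(captured s x p) -/(rename_bound s x p).
    apply/andP; split; last by apply: IH; exists u; rewrite ?upd_other.
    apply: contraNneq (rename_bound_notin s x p) => <-.
    by apply/capturedP; exists u.
Qed.

Lemma Fm_subst p s :
  Fm p -> (forall u, u \in fvars p -> Fm (s u)) -> Fm (subst s p).
Proof.
elim: p s => [n|c|p IH|p IHp q IHq|p IHp q IHq|p IHp q IHq|p IHp q IHq|p IH
               |x p IH] s //=.
- by move=> _; apply; rewrite inE.
- exact: IH.
1-4: by move=> /andP[Fp Fq] Fs; rewrite IHp ?IHq // => u uq; apply: Fs;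
     rewrite mem_cat uq ?orbT.
- exact: IH.
move=> /andP[xp Fp] Fs; apply/andP; split.
  by apply/fvars_substP; exists x; rewrite // upd_same inE.
apply: IH => // u up; rewrite /upd; case: eqP => // /eqP ux.
by apply: Fs; rewrite mem_filter ux.
Qed.

(* The two sides choose different bound variables below a quantifier; both are
   renamed to a common fresh one, and the induction hypothesis absorbs the
   renamings. *)
Lemma subst_comp p s r :
  alpha (subst r (subst s p)) (subst (fun u => subst r (s u)) p).
Proof.
elim: p s r => [n|c|p IH|p IHp q IHq|p IHp q IHq|p IHp q IHq|p IHp q IHq|p IH
               |x p IH] s r; try by (constructor; auto).
have rename s' y z : y \notin captured s' x p ->
    z \notin fvars (subst (upd s' x (Var y)) p) ->
    alpha (All y (subst (upd s' x (Var y)) p))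
          (All z (subst (upd s' x (Var z)) p)).
  move=> yc zf; apply: (alpha_trans (alpha_rename y zf)); apply: alpha_all.
  apply: alpha_trans (IH _ _) _.
  rewrite (@subst_ext p _ (upd s' x (Var z))); first exact: alpha_refl.
  move=> u up; rewrite /upd; case: eqP => [_|/eqP ux] /=; first by rewrite eqxx.
  apply: subst_id => w wu; case: eqP => // wy; case/negP: yc.
  by apply/capturedP; exists u; rewrite -wy.
set sr := fun u => subst r (s u).
rewrite (subst_All s) (subst_All r) (subst_All sr).
set y := rename_bound s x p; set P := subst (upd s x _) p.
set y2 := rename_bound r y P; set y3 := rename_bound sr x p.
have E : alpha (subst (upd r y (Var y2)) P) (subst (upd sr x (Var y2)) p).
  apply: alpha_trans (IH _ _) _.
  rewrite (@subst_ext p _ (upd sr x (Var y2))); first exact: alpha_refl.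
  move=> u up; rewrite /upd; case: eqP => [_|/eqP ux] /=; first by rewrite eqxx.
  apply: subst_ext => w wu; case: eqP => // wy.
  case/negP: (rename_bound_notin s x p); rewrite -/y -wy.
  by apply/capturedP; exists u.
apply: alpha_trans (alpha_all _ E) _.
have [z zn] : exists z, z \notin fvars (subst (upd sr x (Var y2)) p) ++
                               fvars (subst (upd sr x (Var y3)) p).
  by eexists; apply: fresh_notin.
move: zn; rewrite mem_cat negb_or => /andP[z2 z3].
apply: alpha_trans (rename sr y2 z _ z2) _; last first.
  by apply/alpha_sym/rename; rewrite ?rename_bound_notin.
(* It remains that [y2] is not captured by [sr]. A free [y2] in [subst r (s u)] comes from some [w]
   free in [s u]; this [w] is free in [P] and differs from [y], so [y2] would already be captured by
   [r] in [P]. *)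
apply/capturedP => -[u [up ux /fvars_substP[w wu yw]]].
case/negP: (rename_bound_notin r y P); rewrite -/y2; apply/capturedP.
exists w; split=> //.
  by apply/fvars_substP; exists u; rewrite ?upd_other.
apply: contraNneq (rename_bound_notin s x p); rewrite -/y => <-.
by apply/capturedP; exists u.
Qed.

Lemma Fm_subst1 p x q : Fm p -> Fm q -> Fm (subst1 p x q).
Proof. by move=> Fp Fq; apply: Fm_subst => // u _; rewrite /upd; case: ifP. Qed.

Lemma subst1_notin p x q : x \notin fvars p -> subst1 p x q = p.
Proof.
move=> xp; apply: subst_id => u up; rewrite upd_other //.
by apply: contraNneq xp => <-.
Qed.

Lemma subst1_rename p x z q :
  z \notin fvars p -> alpha (subst1 (subst1 p x (Var z)) z q) (subst1 p x q).
Proof.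
move=> zp; apply: alpha_trans (subst_comp _ _ _) _.
rewrite (@subst_ext p _ (upd Var x q)); first exact: alpha_refl.
move=> u up; rewrite /upd; case: eqP => _ /=; first by rewrite eqxx.
by rewrite ifN //; apply: contraNneq zp => <-.
Qed.

(** The chosen bound variable is free in no [s u] inserted for a [u] other than [x], so
    instantiating it affects only the former places of [x]. Hence the body of [subst s (All x p)]
    represents the map from [q] to [subst (upd s x q) p]. *)
Lemma subst1_bound p s x q :
  alpha (subst1 (subst (upd s x (Var (rename_bound s x p))) p)
                (rename_bound s x p) q)
        (subst (upd s x q) p).
Proof.
apply: alpha_trans (subst_comp _ _ _) _.
rewrite (@subst_ext p _ (upd s x q)); first exact: alpha_refl.
move=> u up; rewrite /upd; case: eqP => [_|/eqP ux] /=; first by rewrite eqxx.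
apply: subst_id => w wu; rewrite ifN //.
apply: contraNneq (rename_bound_notin s x p) => <-.
by apply/capturedP; exists u.
Qed.

End Substitution.

(** * Derivations from subsets of Fm(C) stay in Fm(C) *)

Section Derivability.
Variable C : constants.
Implicit Types (phi psi chi : fm C) (Phi Psi : fm C -> Prop).

Lemma Fm_pl_inst (s : nat -> fm C) p :
  (forall n, Fm (s n)) -> Fm (pl_inst s p).
Proof. by move=> Fs; elim: p => //= p -> q ->. Qed.

Lemma Fm_All x phi : Fm (All x phi) -> x \in fvars phi /\ Fm phi.
Proof. by move=> /= /andP. Qed.

Lemma axiom3_Fm phi : axiom3 phi -> Fm phi.
Proof.
elim=> {phi} /=; try by move=> *; rewrite ?mem_cat;
  repeat match goal with H : is_true (_ && _) |- _ => case/andP: H => ? ? end;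
  rewrite ?Fm_subst1 //=; repeat (apply/andP; split); rewrite ?mem_cat ?orbT //;
  apply/orP; auto.
- by move=> p s _ /Fm_pl_inst.
Qed.

Lemma derives_Fm Phi phi : fm_set Phi -> derives Phi phi -> Fm phi.
Proof.
move=> FPhi; elim=> {phi} //=; first exact: axiom3_Fm.
  by move=> phi psi _ _ _ /andP[].
exact: axiom3_Fm.
Qed.

End Derivability.

(** * Maximally consistent sets and the quotient by the identities they contain *)

Section Maximal.
Variable C : constants.
Implicit Types (phi psi chi : fm C) (Phi Psi : fm C -> Prop).

(** Propositional letters are indices into [l]. The default [Top C] is itself in Fm(C), so letters
    beyond the list also meet the premise of [ax_taut]. *)
Lemma derives_taut Phi (l : seq (fm C)) p :
  tautology p -> all (@Fm C) l -> derives Phi (pl_inst (nth (Top C) l) p).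
Proof.
move=> tp Fl; apply/derives_ax/ax_taut => // n.
have [nl|nl] := ltnP n (size l); last by rewrite nth_default.
exact: (all_nthP _ Fl).
Qed.

(** Necessitation applies to axioms only, so a necessitated formula never depends on the extra
    hypothesis and can be weakened like an axiom. *)
Lemma deduction Phi phi psi : fm_set Phi -> Fm phi ->
  derives (fun chi => Phi chi \/ chi = phi) psi -> derives Phi (Imp phi psi).
Proof.
move=> FPhi Fphi.
have weaken chi : derives Phi chi -> derives Phi (Imp phi chi).
  move=> dchi; have Fchi := derives_Fm FPhi dchi; apply: derives_mp dchi _.
  apply: (@derives_taut _ [:: chi; phi]
    (PImp (PVar 0) (PImp (PVar 1) (PVar 0)))).
    by move=> v /=; case: (v 0); case: (v 1).
  by rewrite /= Fphi Fchi.
elim=> {psi} [psi [Ppsi| ->]|psi apsi|psi chi _ IHpsi _ IHimp|psi apsi].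
- exact/weaken/derives_hyp.
- apply: (@derives_taut _ [:: phi] (PImp (PVar 0) (PVar 0))).
    by move=> v /=; case: (v 0).
  by rewrite /= Fphi.
- exact/weaken/derives_ax.
- have /= /and3P[_ Fpsi Fchi] := derives_Fm FPhi IHimp.
  apply: derives_mp IHimp _; apply: derives_mp IHpsi _.
  apply: (@derives_taut _ [:: phi; psi; chi]
    (PImp (PImp (PVar 0) (PVar 1))
      (PImp (PImp (PVar 0) (PImp (PVar 1) (PVar 2)))
        (PImp (PVar 0) (PVar 2))))).
    by move=> v /=; case: (v 0); case: (v 1); case: (v 2).
  by rewrite /= Fphi Fpsi Fchi.
- exact/weaken/derives_nec.
Qed.

Variable Phi : fm C -> Prop.
Hypothesis mPhi : maximally_consistent Phi.

Lemma maximal_Fm : fm_set Phi.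
Proof. by case: mPhi. Qed.

(** Adding a derivable [phi] keeps [Phi] consistent: by the deduction theorem, a contradiction would
    turn into one from [Phi] alone. *)
Lemma maximal_derives phi : derives Phi phi -> Phi phi.
Proof.
have [FPhi cPhi maxPhi] := mPhi => dphi.
apply: (maxPhi (fun chi => Phi chi \/ chi = phi)); last by right.
- by move=> chi [/FPhi//| ->]; apply: derives_Fm dphi.
- by left.
- move=> dBot; apply: cPhi; apply: (derives_mp dphi).
  by apply: deduction => //; apply: derives_Fm dphi.
Qed.

Lemma maximal_axiom phi : axiom3 phi -> Phi phi.
Proof. by move=> aphi; apply/maximal_derives/derives_ax. Qed.

Lemma maximal_nec phi : axiom3 phi -> Phi (Box phi).
Proof. by move=> aphi; apply/maximal_derives/derives_nec. Qed.

Lemma maximal_mp phi psi : Phi phi -> Phi (Imp phi psi) -> Phi psi.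
Proof.
by move=> Pphi Pimp; apply: maximal_derives;
   apply: derives_mp (derives_hyp Pphi) (derives_hyp Pimp).
Qed.

Lemma maximal_neg phi : Fm phi -> Phi (Neg phi) <-> ~ Phi phi.
Proof.
move=> Fphi; have [FPhi cPhi maxPhi] := mPhi; split=> [nphi pphi|nphi].
  apply: cPhi; apply: derives_mp (derives_hyp pphi) _.
  apply: derives_mp (derives_hyp nphi) _.
  apply: (@derives_taut _ [:: phi]
    (PImp (PNeg (PVar 0)) (PImp (PVar 0) PBot))).
    by move=> v /=; case: (v 0).
  by rewrite /= Fphi.
have dBot : derives Phi (Imp phi (Bot C)).
  apply: deduction => //; apply: NNPP => ndBot; apply: nphi.
  apply: (maxPhi (fun chi => Phi chi \/ chi = phi)) => //; last by right.
    by move=> chi [/FPhi//| ->].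
  by left.
apply: maximal_derives; apply: derives_mp dBot _.
apply: (@derives_taut _ [:: phi]
  (PImp (PImp (PVar 0) PBot) (PNeg (PVar 0)))).
  by move=> v /=; case: (v 0).
by rewrite /= Fphi.
Qed.

Lemma maximal_eqv_refl phi : Fm phi -> Phi (Eqv phi phi).
Proof.
by move=> Fphi; apply/maximal_axiom/ax_alpha => //; apply: alpha_refl.
Qed.

Lemma maximal_eqv_mp phi psi : Phi (Eqv phi psi) -> Phi phi -> Phi psi.
Proof.
move=> e pphi; have /= /andP[Fphi Fpsi] := maximal_Fm e.
by apply: maximal_mp pphi (maximal_mp e _); apply/maximal_axiom/ax_eqv_imp.
Qed.

Lemma maximal_eqv_subst phi x psi psi' : Fm phi ->
  Phi (Eqv psi psi') -> Phi (Eqv (subst1 phi x psi) (subst1 phi x psi')).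
Proof.
move=> Fphi e; have /= /andP[Fpsi Fpsi'] := maximal_Fm e.
have [xphi|xphi] := boolP (x \in fvars phi).
  by apply: maximal_mp e _; apply/maximal_axiom/ax_eqv_subst.
by rewrite !subst1_notin //; apply: maximal_eqv_refl.
Qed.

(** Axiom (vii) in the context [Eqv (Var z) phi], with [z] fresh, identifies [Eqv phi phi] with
    [Eqv psi phi]. Transitivity uses the context [Eqv phi (Var z)] in the same way. *)
Lemma maximal_eqv_sym phi psi : Phi (Eqv phi psi) -> Phi (Eqv psi phi).
Proof.
move=> e; have /= /andP[Fphi Fpsi] := maximal_Fm e.
have zn := fresh_notin (fvars phi); set z := fresh _ in zn.
have := @maximal_eqv_subst (Eqv (Var z) phi) z _ _ Fphi e.
rewrite /subst1 /= !upd_same -!/(subst1 _ _ _) !subst1_notin // => e'.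
exact: maximal_eqv_mp e' (maximal_eqv_refl Fphi).
Qed.

Lemma maximal_eqv_trans phi psi chi :
  Phi (Eqv phi psi) -> Phi (Eqv psi chi) -> Phi (Eqv phi chi).
Proof.
move=> e1 e2; have /= /andP[Fphi _] := maximal_Fm e1.
have zn := fresh_notin (fvars phi); set z := fresh _ in zn.
have := @maximal_eqv_subst (Eqv phi (Var z)) z _ _ _ e2.
rewrite /subst1 /= !upd_same -!/(subst1 _ _ _) !subst1_notin // andbT => e3.
exact: maximal_eqv_mp (e3 Fphi) e1.
Qed.

(** The quotient is realised as the set of chosen representatives, the fixed points of [canon].
    Since [cls] is total on [fm C], [nf] first sends everything outside Fm(C) to [Top C]. *)
Lemma term_quotient :
  exists (Q : Type) (cls : fm C -> Q) (rep : Q -> fm C),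
    [/\ forall a, Fm (rep a), forall a, cls (rep a) = a &
        forall phi psi, Fm phi -> Fm psi ->
          (cls phi = cls psi <-> Phi (Eqv phi psi))].
Proof.
pose nf phi := if Fm phi then phi else Top C.
have Fnf phi : Fm (nf phi) by rewrite /nf; case: ifP.
pose canon phi :=
  epsilon (inhabits (Top C)) (fun psi => Phi (Eqv (nf phi) psi)).
have canonP phi : Phi (Eqv (nf phi) (canon phi)).
  apply: (epsilon_spec _ (fun psi => Phi (Eqv (nf phi) psi))).
  by exists (nf phi); apply: maximal_eqv_refl.
have Fcanon phi : Fm (canon phi) by have /andP[] := maximal_Fm (canonP phi).
have canonE phi psi :
    Phi (Eqv (nf phi) (nf psi)) -> canon phi = canon psi.
  (* Identified formulas have the same class as a predicate, and [epsilon] depends on the predicate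
     only. *)
  move=> e; congr (epsilon _ _); apply: functional_extensionality => chi.
  apply: propositional_extensionality; split; apply: maximal_eqv_trans => //.
  exact: maximal_eqv_sym.
have canonK phi : canon (canon phi) = canon phi.
  by apply/canonE/maximal_eqv_sym; rewrite {2}/nf Fcanon; apply: canonP.
exists {phi | canon phi = phi}.
exists (fun phi => exist (fun psi => canon psi = psi) _ (canonK phi)).
exists (fun a => proj1_sig a); split=> [[phi e] /=|[phi e]|phi psi Fphi Fpsi].
- by rewrite -e.
- exact: subset_eq_compat.
have nfE chi : Fm chi -> nf chi = chi by rewrite /nf => ->.
split=> [[e]|e]; last by apply/subset_eq_compat/canonE; rewrite !nfE.
have := canonP phi; rewrite e nfE // => e'; apply: maximal_eqv_trans e' _.
by apply: maximal_eqv_sym; rewrite -{1}(nfE psi Fpsi).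
Qed.

End Maximal.

(** * The canonical domain and its operations on classes *)

Section CanonicalModel.
Variables (C : constants) (Phi : fm C -> Prop).
Hypothesis hPhi : henkin_set Phi.
Variables (Q : Type) (cls : fm C -> Q) (rep : Q -> fm C).
Hypothesis Fm_rep : forall a, Fm (rep a).
Hypothesis repK : forall a, cls (rep a) = a.
Hypothesis cls_eq : forall phi psi, Fm phi -> Fm psi ->
  (cls phi = cls psi <-> Phi (Eqv phi psi)).
Implicit Types (phi psi chi A B P : fm C) (x y z : nat).

Let mPhi : maximally_consistent Phi := proj1 hPhi.

Definition represents (t : Q -> Q) z P : Prop :=
  Fm (All z P) /\ forall chi, Fm chi -> t (cls chi) = cls (subst1 P z chi).

Definition all_value (t : Q -> Q) (q : Q) : Prop :=
  exists z P, represents t z P /\ q = cls (All z P).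

(** [f_all] has to be total on all functions, definable or not. Without a representation the value
    at the class of [Top C] is taken, which for a constant function is its only value. *)
Definition canonical_all (t : Q -> Q) : Q :=
  epsilon (inhabits (t (cls (Top C))))
    (fun q => all_value t q \/
              (~ (exists q', all_value t q')) /\ q = t (cls (Top C))).

Definition canonical : prop_domain C :=
  @PropDomain C Q (fun a => Phi (rep a)) (fun a => Phi (Box (rep a)))
    (cls (Bot C)) (cls (Top C))
    (fun a => cls (Box (rep a))) (fun a => cls (Neg (rep a)))
    (fun a b => cls (Or (rep a) (rep b))) (fun a b => cls (And (rep a) (rep b)))
    (fun a b => cls (Imp (rep a) (rep b)))
    (fun a b => cls (Eqv (rep a) (rep b)))
    canonical_all (fun c => cls (Const c)) erefl erefl.

Local Notation M := canonical.
Local Notation "[ A ]" := (cls A : M) (at level 0, A at level 200).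
Implicit Types (a b c : M) (t : M -> M) (g : nat -> M).

Lemma cls_surj a : exists2 A, Fm A & a = [A].
Proof. by exists (rep a). Qed.

Lemma cls_alpha A B : Fm A -> Fm B -> alpha A B -> [A] = [B].
Proof.
by move=> FA FB AB; apply/cls_eq => //; apply/(maximal_axiom mPhi)/ax_alpha.
Qed.

Lemma cls_subst1 phi x A B : Fm phi -> Fm A -> Fm B ->
  [A] = [B] -> [subst1 phi x A] = [subst1 phi x B].
Proof.
move=> Fphi FA FB /cls_eq e; apply/cls_eq; rewrite ?Fm_subst1 //.
by apply: maximal_eqv_subst => //; apply: e.
Qed.

(** Passing from [rep [A]] to [A] under [op] is axiom (vii) in the context [op (Var 0)]. The two
    hypotheses hold by computation for each connective. *)
Lemma cls_unary (op : fm C -> fm C) :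
  (forall s A, subst s (op A) = op (subst s A)) ->
  (forall A, Fm (op A) = Fm A) ->
  forall A, Fm A -> [op (rep [A])] = [op A].
Proof.
move=> sop Fop A FA.
have := @cls_subst1 (op (Var 0)) 0 (rep [A]) A.
by rewrite /subst1 !sop /= !upd_same Fop repK; apply.
Qed.

Lemma cls_binary (op : fm C -> fm C -> fm C) :
  (forall s A B, subst s (op A B) = op (subst s A) (subst s B)) ->
  (forall A B, Fm (op A B) = Fm A && Fm B) ->
  forall A B, Fm A -> Fm B -> [op (rep [A]) (rep [B])] = [op A B].
Proof.
move=> sop Fop A B FA FB.
have zn := fresh_notin (fvars (rep [B])); set z := fresh _ in zn.
have yn := fresh_notin (fvars A); set y := fresh _ in yn.
(* The arguments are replaced one at a time; each time the variable marking the place is fresh for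
   the other argument. *)
transitivity [op A (rep [B])].
  have := @cls_subst1 (op (Var z) (rep [B])) z (rep [A]) A.
  rewrite /subst1 !sop /= !upd_same -!/(subst1 _ _ _) !subst1_notin //.
  by rewrite Fop /= Fm_rep repK; apply.
have := @cls_subst1 (op A (Var y)) y (rep [B]) B.
rewrite /subst1 !sop /= !upd_same -!/(subst1 _ _ _) !subst1_notin //.
by rewrite Fop /= FA repK; apply.
Qed.

Lemma f_neg_cls A : Fm A -> f_neg [A] = [Neg A].
Proof. exact: cls_unary. Qed.

Lemma f_box_cls A : Fm A -> f_box [A] = [Box A].
Proof. exact: cls_unary. Qed.

Lemma f_imp_cls A B : Fm A -> Fm B -> f_imp [A] [B] = [Imp A B].
Proof. exact: cls_binary. Qed.

Lemma f_or_cls A B : Fm A -> Fm B -> f_or [A] [B] = [Or A B].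
Proof. exact: cls_binary. Qed.

Lemma f_and_cls A B : Fm A -> Fm B -> f_and [A] [B] = [And A B].
Proof. exact: cls_binary. Qed.

Lemma f_eqv_cls A B : Fm A -> Fm B -> f_eqv [A] [B] = [Eqv A B].
Proof. exact: cls_binary. Qed.

Lemma TRUE_cls A : Fm A -> TRUE [A] <-> Phi A.
Proof.
move=> FA; have e : Phi (Eqv (rep [A]) A) by apply/cls_eq; rewrite ?repK.
by split; apply: maximal_eqv_mp => //; apply: maximal_eqv_sym.
Qed.

Lemma TRUE_box a : TRUE (f_box a) <-> NEC a.
Proof. by apply: TRUE_cls; apply: Fm_rep. Qed.

Lemma NEC_cls A : Fm A -> NEC [A] <-> Phi (Box A).
Proof.
move=> FA; apply: iff_trans (iff_sym (TRUE_box _)) _.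
by rewrite f_box_cls //; apply: TRUE_cls.
Qed.

Lemma NEC_axiom phi : axiom3 phi -> NEC [phi].
Proof.
move=> aphi; apply/NEC_cls; first exact: axiom3_Fm.
exact: maximal_nec.
Qed.

Lemma TRUE_axiom phi : axiom3 phi -> TRUE [phi].
Proof.
move=> aphi; apply/TRUE_cls; first exact: axiom3_Fm.
exact: maximal_axiom.
Qed.

Lemma TRUE_neg a : TRUE (f_neg a) <-> ~ TRUE a.
Proof.
have [A FA ->] := cls_surj a; rewrite f_neg_cls //.
split=> [/TRUE_cls-/(_ FA)|nA].
  by move=> /(maximal_neg mPhi FA) nA /TRUE_cls-/(_ FA).
by apply/TRUE_cls => //; apply/(maximal_neg mPhi) => // PA; apply/nA/TRUE_cls.
Qed.

Lemma TRUE_mp a b : TRUE (f_imp a b) -> TRUE a -> TRUE b.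
Proof.
have [A FA ->] := cls_surj a; have [B FB ->] := cls_surj b.
rewrite f_imp_cls // => /TRUE_cls PAB /TRUE_cls PA; apply/TRUE_cls => //.
by apply: (maximal_mp mPhi (PA FA)); apply: PAB; rewrite /= FA FB.
Qed.

Lemma NEC_TRUE a : NEC a -> TRUE a.
Proof.
have [A FA ->] := cls_surj a; rewrite -TRUE_box; apply: TRUE_mp.
by rewrite f_box_cls // f_imp_cls //; apply/TRUE_axiom/ax_T.
Qed.

Lemma NEC_mp a b : NEC (f_imp a b) -> NEC a -> NEC b.
Proof.
have [A FA ->] := cls_surj a; have [B FB ->] := cls_surj b.
rewrite -!TRUE_box => Nab; apply: TRUE_mp; apply: TRUE_mp Nab.
have FAB : Fm (Imp A B) by rewrite /= FA FB.
rewrite !(f_box_cls, f_imp_cls) //.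
exact/TRUE_axiom/ax_K.
Qed.

(** * Propositional reasoning inside the canonical model *)

Fixpoint pl_val (v : nat -> M) (p : pl) : M :=
  match p with
  | PVar n => v n
  | PTop => f_top M
  | PBot => f_bot M
  | PNeg q => f_neg (pl_val v q)
  | PImp q r => f_imp (pl_val v q) (pl_val v r)
  | POr q r => f_or (pl_val v q) (pl_val v r)
  | PAnd q r => f_and (pl_val v q) (pl_val v r)
  end.

Lemma pl_val_cls v p : pl_val v p = [pl_inst (fun n => rep (v n)) p].
Proof.
have FI q : Fm (pl_inst (fun n => rep (v n)) q) by apply: Fm_pl_inst.
elim: p => //= [p ->|p -> q ->|p -> q ->|p -> q ->].
- exact: f_neg_cls.
- exact: f_imp_cls.
- exact: f_or_cls.
- exact: f_and_cls.
Qed.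

Lemma NEC_taut v p : tautology p -> NEC (pl_val v p).
Proof. by move=> tp; rewrite pl_val_cls; apply/NEC_axiom/ax_taut. Qed.

Lemma TRUE_taut v p : tautology p -> TRUE (pl_val v p).
Proof. by move=> /NEC_taut-/(_ v)/NEC_TRUE. Qed.

(** The tactic [taut l] reifies a goal [TRUE t] or [NEC t] over the atoms in [l] and checks the
    truth table, for at most four atoms; [leM] and [approxM] are unfolded first. *)
Ltac atom_index l t :=
  lazymatch l with
  | t :: _ => constr:(0)
  | _ :: ?l' => let n := atom_index l' t in constr:(n.+1)
  end.

Ltac reify l t :=
  lazymatch t with
  | f_top _ => constr:(PTop)
  | f_bot _ => constr:(PBot)
  | f_neg ?x => let p := reify l x in constr:(PNeg p)
  | f_imp ?x ?y =>
      let p := reify l x in let q := reify l y in constr:(PImp p q)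
  | f_or ?x ?y =>
      let p := reify l x in let q := reify l y in constr:(POr p q)
  | f_and ?x ?y =>
      let p := reify l x in let q := reify l y in constr:(PAnd p q)
  | _ => let n := atom_index l t in constr:(PVar n)
  end.

Ltac taut_in lem l t :=
  let p := reify l t in
  refine (lem (nth (f_top M) l) p _);
  let v := fresh "v" in move=> v /=;
  try case: (v 0); try case: (v 1); try case: (v 2); try case: (v 3);
  done.

Ltac taut l :=
  rewrite ?/approxM ?/leM;
  lazymatch goal with
  | |- _ /\ _ => split; taut l
  | |- TRUE ?t => taut_in TRUE_taut l t
  | |- NEC ?t => taut_in NEC_taut l t
  end.

Lemma TRUE_imp a b : TRUE (f_imp a b) <-> (TRUE a -> TRUE b).
Proof.
split=> [|ab]; first exact: TRUE_mp.
have [Ta|/TRUE_neg nTa] := classic (TRUE a).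
  by apply: TRUE_mp (ab Ta); taut [:: a; b].
by apply: TRUE_mp nTa; taut [:: a; b].
Qed.

Lemma TRUE_and a b : TRUE (f_and a b) <-> TRUE a /\ TRUE b.
Proof.
split=> [Tab|[Ta Tb]].
  by split; apply: TRUE_mp Tab; taut [:: a; b].
by apply: TRUE_mp Tb; apply: TRUE_mp Ta; taut [:: a; b].
Qed.

Lemma TRUE_or a b : TRUE (f_or a b) <-> TRUE a \/ TRUE b.
Proof.
split=> [Tab|[]].
- have [Ta|/TRUE_neg nTa] := classic (TRUE a); first by left.
  by right; apply: TRUE_mp Tab; apply: TRUE_mp nTa; taut [:: a; b].
- by apply: TRUE_mp; taut [:: a; b].
- by apply: TRUE_mp; taut [:: a; b].
Qed.

Lemma leM_trans a b c : leM a b -> leM b c -> leM a c.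
Proof.
by move=> ab; apply: NEC_mp; apply: NEC_mp ab; taut [:: a; b; c].
Qed.

(** Each clause is a necessary tautology, or follows from its hypotheses and one such tautology by
    [NEC_mp]. *)
Lemma canonical_prealgebra : boolean_prealgebra M.
Proof.
split.
- by move=> a; taut [:: a].
- exact: leM_trans.
- move=> a a' [h h']; split.
    by apply: NEC_mp h'; taut [:: a; a'].
  by apply: NEC_mp h; taut [:: a; a'].
1-3: move=> a a' b b' [ha ha'] [hb hb']; split; apply: NEC_mp ha';
     apply: NEC_mp ha; apply: NEC_mp hb'; apply: NEC_mp hb;
     taut [:: a; a'; b; b'].
1-2: by move=> a b; taut [:: a; b].
1-2: by move=> a b c; taut [:: a; b; c].
1-2: by move=> a b; taut [:: a; b].
1-2: by move=> a b c; taut [:: a; b; c].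
1-4: by move=> a; taut [:: a].
- by move=> a b; taut [:: a; b].
- move=> a b; split=> [ab|[_ ab]].
    split; first by taut [:: a; b].
    by apply: NEC_mp ab; taut [:: a; b].
  by apply: NEC_mp ab; taut [:: a; b].
Qed.

(** * Values of the universal quantifier *)

Lemma henkin_all z P : Fm (All z P) ->
  (forall c : C, Phi (subst1 P z (Const c))) -> Phi (All z P).
Proof.
move=> FP Pc; apply: (maximal_derives mPhi); apply/(proj2 hPhi) => // c.
exact/derives_hyp/Pc.
Qed.

Lemma represents_rename t z y P : represents t z P -> y \notin fvars P ->
  represents t y (subst1 P z (Var y)) /\
  [All z P] = [All y (subst1 P z (Var y))].
Proof.
move=> [FzP tP] yP; have [zP FP] := Fm_All FzP.
have FyP : Fm (All y (subst1 P z (Var y))).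
  rewrite /= Fm_subst1 // andbT; apply/fvars_substP.
  by exists z; rewrite // upd_same inE.
split; last by apply: cls_alpha => //; apply: alpha_rename.
split=> // chi Fchi; rewrite tP //; apply: cls_alpha; rewrite ?Fm_subst1 //.
exact/alpha_sym/subst1_rename.
Qed.

(** Only finitely many bound variables are excluded, so two representations can be moved to a common
    one, as axiom (viii) demands. *)
Lemma all_value_fresh t q : all_value t q ->
  exists l : seq nat, forall z, z \notin l ->
    exists P, represents t z P /\ q = [All z P].
Proof.
move=> [z [P [tP ->]]]; exists (fvars P) => y yP.
by exists (subst1 P z (Var y)); apply: represents_rename.
Qed.

Lemma all_value_uniq t q q' : all_value t q -> all_value t q' -> q = q'.
Proof.
move=> /all_value_fresh[l lP] /all_value_fresh[l' lP'].
have := fresh_notin (l ++ l'); set z := fresh _.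
rewrite mem_cat negb_or => /andP[/lP[P [[FzP tP] ->]] /lP'[P' [[FzP' tP'] ->]]].
apply/cls_eq => //; apply: (maximal_mp mPhi); last first.
  exact/(maximal_axiom mPhi)/ax_all_eqv.
have [zP FP] := Fm_All FzP; have [zP' FP'] := Fm_All FzP'.
(* Only constant instances have to be compared, and there both sides have the class of the same
   value of [t]. *)
apply: henkin_all => [|c]; first by rewrite /= mem_cat zP FP FP'.
apply/cls_eq; rewrite ?Fm_subst // -?tP -?tP' // => u _;
  by rewrite /upd; case: ifP.
Qed.

Lemma canonical_all_spec t :
  all_value t (canonical_all t) \/
  ~ (exists q, all_value t q) /\ canonical_all t = t (cls (Top C)).
Proof.
apply: (epsilon_spec _ (fun q => all_value t q \/
  ~ (exists q', all_value t q') /\ q = t (cls (Top C)))).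
have [[q tq]|nt] := classic (exists q, all_value t q); first by exists q; left.
by exists (t (cls (Top C))); right.
Qed.

Lemma f_all_value t q : all_value t q -> f_all t = q.
Proof.
move=> tq; case: (canonical_all_spec t) => [tq'|[nt _]].
  exact: (all_value_uniq tq').
by case: nt; exists q.
Qed.

Lemma f_all_no_value t :
  ~ (exists q, all_value t q) -> f_all t = t (f_top M).
Proof.
move=> nt; case: (canonical_all_spec t) => [tq|[_ tE]]; last exact: tE.
by case: nt; exists (canonical_all t).
Qed.

(** Induction with [g] and [s] general, as both are updated below a quantifier. In that case the
    body of [subst s (All x p)] represents the function to which [f_all] is applied, by
    [subst1_bound]. *)
Lemma eval_cls p g s : Fm p -> (forall u, Fm (s u)) ->
  (forall u, g u = [s u]) -> eval g p = [subst s p].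
Proof.
elim: p g s => [n|c|p IH|p IHp q IHq|p IHp q IHq|p IHp q IHq|p IHp q IHq|p IH
               |x p IH] g s //=.
- by move=> Fp Fs gs; rewrite (IH g s) //; apply: f_neg_cls; apply: Fm_subst.
- move=> /andP[Fp Fq] Fs gs.
  by rewrite (IHp g s) // (IHq g s) //; apply: f_imp_cls; apply: Fm_subst.
- move=> /andP[Fp Fq] Fs gs.
  by rewrite (IHp g s) // (IHq g s) //; apply: f_or_cls; apply: Fm_subst.
- move=> /andP[Fp Fq] Fs gs.
  by rewrite (IHp g s) // (IHq g s) //; apply: f_and_cls; apply: Fm_subst.
- move=> /andP[Fp Fq] Fs gs.
  by rewrite (IHp g s) // (IHq g s) //; apply: f_eqv_cls; apply: Fm_subst.
- by move=> Fp Fs gs; rewrite (IH g s) //; apply: f_box_cls; apply: Fm_subst.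
move=> /andP[xp Fp] Fs gs; apply: f_all_value.
exists (rename_bound s x p), (subst (upd s x (Var (rename_bound s x p))) p).
have Fupd chi u : Fm chi -> Fm (upd s x chi u) by rewrite /upd; case: ifP.
split=> //; split=> [|chi Fchi].
  by apply: (@Fm_subst _ (All x p)) => //=; rewrite xp.
rewrite (IH _ (upd s x chi)) // => [|u|u]; last by rewrite /upd; case: ifP.
  apply: cls_alpha; last exact/alpha_sym/subst1_bound.
    by rewrite Fm_subst // => u _; apply: Fupd.
  by rewrite Fm_subst1 // Fm_subst // => u _; apply: Fupd.
exact: Fupd.
Qed.

Lemma definable_cls phi x g t chi : definable_by phi x g t -> Fm chi ->
  t [chi] = [subst (upd (fun u => rep (g u)) x chi) phi].
Proof.
move=> [Fphi ->] Fchi; by apply: eval_cls => // u; rewrite /upd; case: ifP.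
Qed.

Lemma definable_free phi x g t : definable_by phi x g t ->
  x \in fvars phi -> exists q, all_value t q.
Proof.
move=> dt xphi; have [Fphi _] := dt; set s := fun u => rep (g u).
set y := rename_bound s x phi; set P := subst (upd s x (Var y)) phi.
have Fupd chi u : Fm chi -> Fm (upd s x chi u) by rewrite /upd /s; case: ifP.
have FyP : Fm (All y P).
  by apply: (@Fm_subst _ (All x phi) s);
    rewrite /= ?xphi // => u _; apply: Fm_rep.
exists [All y P], y, P; split=> //; split=> // chi Fchi.
have [_ FP] := Fm_All FyP.
rewrite (definable_cls dt Fchi); apply: cls_alpha;
  last exact/alpha_sym/subst1_bound.
  by rewrite Fm_subst // => u _; apply: Fupd.
exact: Fm_subst1.
Qed.

Lemma definable_notin phi x g t : definable_by phi x g t ->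
  x \notin fvars phi -> forall a b, t a = t b.
Proof.
move=> dt xphi a b; have [A FA ->] := cls_surj a; have [B FB ->] := cls_surj b.
rewrite !(definable_cls dt) //; congr cls; apply: subst_ext => u up.
by rewrite !upd_other //; apply: contraNneq xphi => <-.
Qed.

(** The split is on the existence of a representation and not on [x] being free in [phi]: a function
    defined without [x] may still be represented by another formula, which then determines
    [f_all]. *)
Lemma f_all_cases t : definable t ->
  all_value t (f_all t) \/ forall a, t a = f_all t.
Proof.
move=> [phi [x [g dt]]].
have [[q tq]|nq] := classic (exists q, all_value t q).
  by left; rewrite (f_all_value tq).
right=> a; rewrite f_all_no_value //; apply: (definable_notin dt).
by apply/negP => xphi; apply/nq/(definable_free dt).
Qed.

Lemma f_all_lower t a : definable t -> leM (f_all t) (t a).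
Proof.
move=> /f_all_cases[[z [P [[FzP tP] ->]]]|->]; last first.
  by set b := f_all t; taut [:: b].
have [zP FP] := Fm_All FzP; have [A FA ->] := cls_surj a.
rewrite tP // /leM. rewrite f_imp_cls ?Fm_subst1 //.
exact/NEC_axiom/ax_all_inst.
Qed.

Lemma f_all_glb t b : definable t -> (forall a, leM b (t a)) ->
  leM b (f_all t).
Proof.
move=> /f_all_cases[/all_value_fresh[l lP] bt|tE bt]; last first.
  by rewrite -(tE (f_top M)).
have [B FB bE] := cls_surj b.
(* Avoiding the variables of [B] leaves [B] unchanged in instances of [Imp B P] and makes axiom (xi)
   applicable. *)
have := fresh_notin (l ++ fvars B); set z := fresh _.
rewrite mem_cat negb_or => /andP[/lP[P [[FzP tP] ->]] zB].
have [zP FP] := Fm_All FzP.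
have Nall : NEC [All z (Imp B P)].
  apply/NEC_cls; first by rewrite /= mem_cat zP orbT FB.
  apply: (maximal_mp mPhi); last first.
    by apply/(maximal_axiom mPhi)/ax_all_box; rewrite /= mem_cat zP orbT FB.
  apply: henkin_all => [|c]; first by rewrite /= mem_cat zP orbT FB.
  rewrite /subst1 /= -!/(subst1 _ _ _) (subst1_notin _ zB).
  apply/NEC_cls; first by rewrite /= FB Fm_subst1.
  by rewrite -f_imp_cls ?Fm_subst1 // -tP // -bE; apply: bt.
rewrite bE /leM f_imp_cls //; apply: NEC_mp Nall.
rewrite f_imp_cls /= ?mem_cat ?zP ?orbT ?FB //.
exact/NEC_axiom/ax_all_const.
Qed.

Lemma TRUE_all t : definable t -> (forall a, TRUE (t a)) -> TRUE (f_all t).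
Proof.
move=> /f_all_cases[[z [P [[FzP tP] ->]]] Tt|tE Tt]; last first.
  by rewrite -(tE (f_top M)).
apply/TRUE_cls => //; apply: henkin_all => // c; have [zP FP] := Fm_All FzP.
by apply/TRUE_cls; rewrite ?Fm_subst1 // -tP.
Qed.

(** * Verification of the model conditions *)

Lemma canonical_truth : truth_conditions M.
Proof.
split.
- move=> /TRUE_cls-/(_ isT) PBot; case: mPhi => _ + _.
  by apply; apply: derives_hyp.
- by have := @TRUE_taut (fun=> f_top M) PTop; apply.
- exact: TRUE_imp.
- exact: TRUE_neg.
- exact: TRUE_and.
- exact: TRUE_or.
- exact: TRUE_box.
- move=> a b; have [A FA ->] := cls_surj a; have [B FB ->] := cls_surj b.
  rewrite f_eqv_cls //; apply: iff_trans (iff_sym (cls_eq FA FB)).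
  by apply: TRUE_cls; rewrite /= FA FB.
- exact: TRUE_all.
Qed.

Lemma NEC_top : NEC (f_top M).
Proof. by have := @NEC_taut (fun=> f_top M) PTop; apply. Qed.

Lemma canonical_nec : nec_conditions M.
Proof.
split=> [a|a b Na ab|a b Na Nb]; first exact: NEC_TRUE.
  exact: NEC_mp ab Na.
by apply: NEC_mp Nb; apply: NEC_mp Na; taut [:: a; b].
Qed.

(** Residuation moves the premise of an implication to the left, where [f_all_glb] can be applied,
    and back again. *)
Lemma leM_and a b c : leM (f_and a b) c <-> leM a (f_imp b c).
Proof. by split; apply: NEC_mp; taut [:: a; b; c]. Qed.

(** The implication between the boxes must be necessary; axiom (iv) gives this, while (iii) gives
    only its truth. *)
Lemma f_box_mono a b : leM a b -> leM (f_box a) (f_box b).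
Proof.
have [A FA ->] := cls_surj a; have [B FB ->] := cls_surj b.
rewrite /leM -!TRUE_box; apply: TRUE_mp.
have FAB : Fm (Imp A B) by rewrite /= FA FB.
rewrite !(f_box_cls, f_imp_cls) //.
exact/TRUE_axiom/ax_S3.
Qed.

Lemma definable_box t : definable t -> definable (fun a => f_box (t a)).
Proof.
by move=> [phi [x [g [Fphi tphi]]]]; exists (Box phi), x, g; split=> // m;
   rewrite tphi.
Qed.

(** At each point [f_all t] and [f_all t1] together lie below [t2 a] by modus ponens, hence below
    [f_all t2]. The argument is uniform in whether [x] is free in [phi] or [psi]. *)
Lemma f_all_imp phi psi x g t1 t2 t :
  definable_by phi x g t1 -> definable_by psi x g t2 ->
  (forall a, t a = f_imp (t1 a) (t2 a)) ->
  leM (f_all t) (f_imp (f_all t1) (f_all t2)).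
Proof.
move=> d1 d2 tE.
have dt : definable t.
  exists (Imp phi psi), x, g; case: d1 d2 => [F1 e1] [F2 e2].
  by split=> [|m]; rewrite /= ?F1 // tE e1 e2.
have dt1 : definable t1 by exists phi, x, g.
have dt2 : definable t2 by exists psi, x, g.
apply/leM_and; apply: f_all_glb => // a; apply/leM_and.
have := f_all_lower a dt; have := f_all_lower a dt1; rewrite tE.
set u := t1 a; set v := t2 a; set w := f_all t1; set b := f_all t.
by move=> h1; apply: NEC_mp; apply: NEC_mp h1; taut [:: u; v; w; b].
Qed.

Lemma f_box_all t : definable t ->
  approxM (f_box (f_all t)) (f_all (fun a => f_box (t a))).
Proof.
move=> dt; have dbt := definable_box dt; split.
  by apply: f_all_glb => // a; apply/f_box_mono/f_all_lower.
(* Here the box stands outside on the larger side, so the bound is not an instance of [f_all_glb].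
   If [P] represents [t], then [Box P] represents the boxed function and axiom (xiii) applies. *)
have [[z [P [[FzP tP] e]]]|e] := f_all_cases dt; last first.
  by have := f_all_lower (f_top M) dbt; rewrite e.
have [zP FP] := Fm_All FzP.
rewrite e (_ : f_all _ = [All z (Box P)]).
  rewrite f_box_cls // /leM f_imp_cls //; exact/NEC_axiom/ax_all_box.
apply: f_all_value; exists z, (Box P); split=> //; split=> // chi Fchi.
by rewrite tP // f_box_cls // Fm_subst1.
Qed.

(** [f_eqv] is no Boolean operation, so lower bounds do not suffice. Freeness of [x] yields
    representations of [t1] and [t2] over one variable; their identity represents [t], and axiom
    (viii) concludes. *)
Lemma f_all_eqv phi psi x g t1 t2 t :
  definable_by phi x g t1 -> definable_by psi x g t2 ->
  x \in fvars phi -> x \in fvars psi ->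
  (forall a, t a = f_eqv (t1 a) (t2 a)) ->
  leM (f_all t) (f_eqv (f_all t1) (f_all t2)).
Proof.
move=> d1 d2 x1 x2 tE.
have [q1 v1] := definable_free d1 x1; have [q2 v2] := definable_free d2 x2.
rewrite (f_all_value v1) (f_all_value v2).
have [l1 lP1] := all_value_fresh v1; have [l2 lP2] := all_value_fresh v2.
have := fresh_notin (l1 ++ l2); set z := fresh _.
rewrite mem_cat negb_or.
move=> /andP[/lP1[P1 [[FzP1 tP1] ->]] /lP2[P2 [[FzP2 tP2] ->]]].
have [zP1 FP1] := Fm_All FzP1; have [zP2 FP2] := Fm_All FzP2.
have FE : Fm (All z (Eqv P1 P2)) by rewrite /= mem_cat zP1 FP1 FP2.
rewrite (_ : f_all t = [All z (Eqv P1 P2)]).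
  rewrite f_eqv_cls // /leM f_imp_cls //=; last by rewrite zP1 zP2 FP1 FP2.
  exact/NEC_axiom/ax_all_eqv.
apply: f_all_value; exists z, (Eqv P1 P2); split=> //; split=> // chi Fchi.
by rewrite tE tP1 // tP2 // f_eqv_cls ?Fm_subst1.
Qed.

Lemma f_eqv_subst t a b :
  definable t -> leM (f_eqv a b) (f_eqv (t a) (t b)).
Proof.
move=> [phi [x [g dt]]]; have [xphi|xphi] := boolP (x \in fvars phi).
  have [q [z [P [[FzP tP] _]]]] := definable_free dt xphi.
  have [zP FP] := Fm_All FzP.
  have [A FA ->] := cls_surj a; have [B FB ->] := cls_surj b.
  have FE : Fm (Eqv (subst1 P z A) (subst1 P z B)) by rewrite /= !Fm_subst1.
  rewrite !tP // !f_eqv_cls ?Fm_subst1 // /leM f_imp_cls //=;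
    last by rewrite FA.
  exact/NEC_axiom/ax_eqv_subst.
(* Now [t] is constant: its value is compared with itself, and a necessary element lies above every
   element. *)
rewrite (definable_notin dt xphi a b); have [B FB ->] := cls_surj (t b).
have: NEC (f_eqv [B] [B]).
  by rewrite f_eqv_cls //; apply/NEC_axiom/ax_alpha => //; apply: alpha_refl.
by set d := f_eqv [B] _; set e := f_eqv a b; apply: NEC_mp; taut [:: d; e].
Qed.

Lemma canonical_axioms : axiom_conditions M.
Proof.
split.
- move=> a; have [A FA ->] := cls_surj a; rewrite f_eqv_cls //.
  have NA : NEC [Eqv A A] by apply/NEC_axiom/ax_alpha => //; apply: alpha_refl.
  by move: NA; set d := [Eqv A A]; apply: NEC_mp; taut [:: d].
- move=> a b; have [A FA ->] := cls_surj a; have [B FB ->] := cls_surj b.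
  have FAB : Fm (Eqv A B) && Fm (Imp A B) by rewrite /= FA FB.
  rewrite f_eqv_cls // f_imp_cls // /leM; case/andP: FAB => *.
  by rewrite f_imp_cls //; apply/NEC_axiom/ax_eqv_imp.
- exact: f_eqv_subst.
- move=> a; have [A FA ->] := cls_surj a.
  by rewrite f_box_cls // /leM f_imp_cls //; apply/NEC_axiom/ax_T.
- move=> a b; have [A FA ->] := cls_surj a; have [B FB ->] := cls_surj b.
  have FAB : Fm (Imp A B) by rewrite /= FA FB.
  rewrite /leM !(f_box_cls, f_imp_cls) //.
  exact/NEC_axiom/ax_K.
- move=> a b; have [A FA ->] := cls_surj a; have [B FB ->] := cls_surj b.
  have FAB : Fm (Imp A B) by rewrite /= FA FB.
  rewrite /leM !(f_box_cls, f_imp_cls) //.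
  exact/NEC_axiom/ax_S3.
- exact: f_all_eqv.
- exact: f_all_imp.
- exact: f_all_lower.
- move=> chi psi x g b t' t [Fchi cchi] bE dt' tE.
  (* The denotation of the sentence [chi] is unaffected by updating [x], so [Imp chi psi] defines
     [t]. *)
  have dt : definable t.
    exists (Imp chi psi), x, g; case: dt' => Fpsi t'E.
    split=> [|m]; first by rewrite /= Fchi.
    rewrite tE t'E bE [RHS]/=; congr (f_imp _ _).
    rewrite (@eval_cls _ g (fun u => rep (g u))) //.
    rewrite (@eval_cls _ (upd g x m) (fun u => rep (upd g x m u))) //.
    by congr cls; apply: subst_ext => u; rewrite cchi.
  have dt'' : definable t' by exists psi, x, g.
  apply/leM_and; apply: f_all_glb => // a; apply/leM_and.
  by rewrite -tE; apply: f_all_lower.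
- exact: f_box_all.
(* Necessary values all lie above [f_top], hence so does their greatest lower bound. *)
- move=> t dt Nt; apply: NEC_mp NEC_top; apply: f_all_glb => // a.
  by move: (Nt a); set d := t a; apply: NEC_mp; taut [:: d].
Qed.

Lemma canonical_s3_model : s3_model M.
Proof.
split=> *; [exact: canonical_prealgebra|exact: canonical_truth
           |exact: canonical_nec|exact: canonical_axioms].
Qed.

Lemma canonical_satisfies phi :
  Fm phi -> satisfies (fun u => [Var u]) phi <-> Phi phi.
Proof.
move=> Fphi; rewrite /satisfies (@eval_cls _ _ Var) // subst_id //.
exact: TRUE_cls.
Qed.

End CanonicalModel.

Theorem theorem26 (C : constants) (Phi : fm C -> Prop) (hPhi : henkin_set Phi) :
  exists (M : prop_domain C) (beta : nat -> M),
    s3_model M /\ normal M /\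
    forall phi : fm C, Fm phi -> (satisfies beta phi <-> Phi phi).
Proof.
have [Q [cls [rep [Frep repK clsE]]]] := term_quotient (proj1 hPhi).
exists (canonical Phi cls rep), (fun u => cls (Var u)); split.
  exact: canonical_s3_model.
split; last exact: canonical_satisfies.
by eexists; apply: NEC_top.
Qed.
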